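(* Let $n\ge 1$ and let $a_1<\cdots<a_n$ be the primary colors. For every non-negative integer $m$ and every commutative monomial $C$ in $a_1,\ldots,a_n$, let $U(C,m)$ be the number of partitions $\lambda\in\mathcal{O}$ with $C(\lambda)=C$ and $|\lambda|=m$, and let $V(C,m)$ be the number of partitions $\nu\in\mathcal{E}$ with $C(\nu)=C$ and $|\nu|=m$. Then $U(C,m)\le V(C,m)$.
   Context: Primary colors $a_1<\cdots<a_n$; secondary colors are the formal products $a_ia_j$ with $1\le i<j\le n$. All colors are totally ordered by $a_1a_2<\cdots<a_1a_n<a_1<a_2a_3<\cdots<a_2a_n<a_2<\cdots<a_{n-1}a_n<a_{n-1}<a_n$ (for each $i$ the block $a_ia_{i+1}<\cdots<a_ia_n<a_i$, blocks increasing with $i$). A colored part $k_p$ is an integer size $k$ with a color $p$. For colored parts, $k_p\succ l_q$ means $k-l\ge \chi(p\le q)$ (where $\chi(A)=1$ if $A$ holds and $0$ otherwise), and $k_p\succeq l_q$ means $k_p\succ l_q$ or $k_p=l_q$. A pair $(a_ka_l,a_ia_j)$ of secondary colors is special if $i<j<k<l$ or $k<i<j<l$. Let $\mathcal{P}$ be the set of parts with primary color and positive size, and $\mathcal{S}$ the set of parts with secondary color and size at least $2$. For $k_p,l_q\in\mathcal{P}\sqcup\mathcal{S}$ define $k_p\gg l_q$ iff: $k_p\succeq (l+1)_q$ when $p$ or $q$ is primary; $k_p\succ (l+1)_q$ when $p,q$ are both secondary and $(p,q)$ is not special; $k_p\succ l_q$ when $(p,q)$ is special. $\mathcal{O}$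 is the set of finite sequences $(\lambda_1,\ldots,\lambda_t)$ (including the empty one) of parts in $\mathcal{P}$ with $\lambda_1\succ\cdots\succ\lambda_t$; $\mathcal{E}$ is the set of finite sequences $(\nu_1,\ldots,\nu_t)$ of parts in $\mathcal{P}\sqcup\mathcal{S}$ with $\nu_1\gg\cdots\gg\nu_t$. The size $|\cdot|$ is the sum of part sizes, and $C(\cdot)$ is the commutative product of the colors of the parts, where a secondary color $a_ia_j$ is viewed as the product of $a_i$ and $a_j$. *)

(* Defs.v *)
From mathcomp Require Import all_boot all_order all_algebra.
From mathcomp Require Import finmap mpoly.
From mathcomp Require Import boolp classical_sets functions cardinality.

Set Implicit Arguments.
Unset Strict Implicit.
Unset Printing Implicit Defensive.

Import Order.TTheory GRing.Theory Num.Theory.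
Local Open Scope ring_scope.

Definition secondary (n : nat) := {ij : 'I_n * 'I_n | (ij.1 < ij.2)%N}.

(* The color a_(i+1) is [inl i], since 'I_n starts at 0. *)
Definition color (n : nat) := ('I_n + secondary n)%type.

Definition primary (n : nat) (p : color n) : bool :=
  if p is inl _ then true else false.

(* The block of i is a_i a_(i+1) < ... < a_i a_(n-1) < a_i (0-based indices), so
   that the order on colors is the lexicographic order on the pairs below. *)
Definition block (n : nat) (p : color n) : nat :=
  match p with inl i => i | inr ij => (val ij).1 end.

Definition block_pos (n : nat) (p : color n) : nat :=
  match p with inl _ => n | inr ij => (val ij).2 end.

Definition color_le (n : nat) (p q : color n) : bool :=
  ((block p < block q) || (block p == block q) && (block_pos p <= block_pos q))%N.

(* (p, q) = (a_k a_l, a_i a_j) *)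
Definition special (n : nat) (p q : color n) : bool :=
  match p, q with
  | inr kl, inr ij =>
      let: (k, l) := val kl in
      let: (i, j) := val ij in
      ((i < j) && (j < k) && (k < l) || (k < i) && (i < j) && (j < l))%N
  | _, _ => false
  end.

Definition part (n : nat) := (int * color n)%type.

(* k_p |-> (k + 1)_p *)
Definition incr_part (n : nat) (x : part n) : part n := (x.1 + 1, x.2).

Definition succ_part (n : nat) (x y : part n) : bool :=
  (color_le x.2 y.2)%:Z <= x.1 - y.1.

Definition succeq_part (n : nat) (x y : part n) : bool :=
  succ_part x y || (x == y).

Definition primary_part (n : nat) (x : part n) : bool :=
  primary x.2 && (1 <= x.1).

Definition secondary_part (n : nat) (x : part n) : bool :=
  ~~ primary x.2 && (2 <= x.1).

Definition gg_part (n : nat) (x y : part n) : bool :=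
  if primary x.2 || primary y.2 then succeq_part x (incr_part y)
  else if special x.2 y.2 then succ_part x y
  else succ_part x (incr_part y).

Definition in_O (n : nat) (s : seq (part n)) : bool :=
  all (@primary_part n) s && sorted (@succ_part n) s.

(* [gg_part] is not transitive: only consecutive parts are compared. *)
Definition in_E (n : nat) (s : seq (part n)) : bool :=
  all (fun x : part n => primary_part x || secondary_part x) s
  && sorted (@gg_part n) s.

Definition psize (n : nat) (s : seq (part n)) : int := \sum_(x <- s) x.1.

Definition color_monomial (n : nat) (p : color n) : 'X_{1..n} :=
  match p with
  | inl i => U_(i)%MM
  | inr ij => (U_((val ij).1) + U_((val ij).2))%MM
  end.

Definition pmonomial (n : nat) (s : seq (part n)) : 'X_{1..n} :=
  (\big[+%MM/0]_(x <- s) color_monomial x.2)%MM.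

Definition O_set (n : nat) (C : 'X_{1..n}) (m : nat) : set (seq (part n)) :=
  [set s | [/\ in_O s, pmonomial s = C & psize s = m%:Z]]%classic.

Definition E_set (n : nat) (C : 'X_{1..n}) (m : nat) : set (seq (part n)) :=
  [set s | [/\ in_E s, pmonomial s = C & psize s = m%:Z]]%classic.

(* [fset_set] is only meaningful on finite sets: see [finite_O_set] and
   [finite_E_set] below. *)
Definition U (n : nat) (C : 'X_{1..n}) (m : nat) : nat :=
  #|` fset_set (O_set C m)|.

Definition V (n : nat) (C : 'X_{1..n}) (m : nat) : nat :=
  #|` fset_set (E_set C m)|.

Lemma psize_bounds (n : nat) (s : seq (part n)) :
  all (fun x : part n => 1 <= x.1) s ->
  (size s)%:Z <= psize s /\ all (fun x : part n => x.1 <= psize s) s.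
Proof.
rewrite /psize; elim: s => [|x s IHs] /=; first by rewrite big_nil.
case/andP=> x_gt0 /IHs[le_size le_all]; rewrite big_cons; split.
  by rewrite -add1n PoszD lerD.
have sum_ge0 : 0 <= \sum_(y <- s) y.1 by apply: le_trans le_size.
rewrite lerDl sum_ge0 /=; apply: sub_all le_all => y /= le_y.
by apply: le_trans le_y _; rewrite lerDr; apply: le_trans x_gt0.
Qed.

Lemma finite_psize (n m : nat) :
  finite_set [set s : seq (part n) |
    all (fun x : part n => 1 <= x.1) s /\ psize s = m%:Z]%classic.
Proof.
pose f (t : m.-bseq ('I_m.+1 * color n)%type) : seq (part n) :=
  [seq ((val x.1)%:Z, x.2) | x <- t].
apply: (@sub_finite_set _ _ (f @` setT)%classic); last first.
  by apply: finite_image; apply: finite_finset.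
move=> s [/= s_pos s_m]; have := psize_bounds s_pos.
rewrite s_m => -[le_size le_all].
pose g (x : part n) : 'I_m.+1 * color n := (inord `|x.1|%N, x.2).
have sz : (size (map g s) <= m)%N by rewrite size_map.
exists (Bseq sz) => //; rewrite /f /= -map_comp -[RHS]map_id.
apply/eq_in_map => x xs /=.
have x_pos : 0 <= x.1 by apply: le_trans (allP s_pos x xs).
have := allP le_all x xs; rewrite -{1}(gez0_abs x_pos) lez_nat => x_le.
by rewrite inordK ?ltnS // gez0_abs //; case: (x).
Qed.

Lemma finite_O_set (n : nat) (C : 'X_{1..n}) (m : nat) : finite_set (O_set C m).
Proof.
apply: sub_finite_set (@finite_psize n m) => s [/andP[s_P _] _ s_m].
by split=> //; apply: sub_all s_P => x /andP[].
Qed.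

Lemma finite_E_set (n : nat) (C : 'X_{1..n}) (m : nat) : finite_set (E_set C m).
Proof.
apply: sub_finite_set (@finite_psize n m) => s [/andP[s_PS _] _ s_m].
split=> //; apply: sub_all s_PS => x /orP[/andP[] // | /andP[_]].
exact: le_trans.
Qed.

(* Main.v *)
(** Read a partition in O from its greatest part to its smallest one, building a
partition in E.  A primary part [y] is appended as long as the last part allows
it.  Otherwise the last part is a primary part [z] with [y < z < y + 1], and [z]
and [y] are replaced by the secondary part [z + y], of which they are the
halves; as long as this secondary part [s] is preceded by a primary part [u]
with [u >> s] false, the two parts [u, s] are replaced by [s + 1, u - 1].

Only the primary parts behind the last secondary part [t] are ever modified.  If
[t] crossed [r] primary parts and had halves [w > v], there are two cases: the
parts behind [t] are those [r] parts, and the last one is at least [w]; or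
[k + 1] parts were appended since then, and the last one is less than [v - k].
This implies that a new secondary part [s] that reaches [t] satisfies [t >> s].
Moreover the two cases exclude each other, so that the final partition tells
whether its last step was an appending or a fusion, and the steps can be undone
one by one. *)

Require Import Defs.
From mathcomp Require Import all_boot mpoly.
From mathcomp Require Import all_order all_algebra finmap zify.
From mathcomp Require Import classical_sets cardinality.

Set Implicit Arguments.
Unset Strict Implicit.
Unset Printing Implicit Defensive.

Import Order.TTheory GRing.Theory Num.Theory.
Local Open Scope ring_scope.

(** * Halves of secondary parts and comparison of colored parts *)

Section Parts.
Variable n : nat.
Implicit Types (x y z s t u v w : part n) (zs F : seq (part n)).

Definition shift (k : int) x : part n := (x.1 + k, x.2).

(** The values [p] are defaults: halves have distinct primary colors. *)
Definition mul_color (p q : color n) : color n :=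
  match p, q with
  | inl i, inl j =>
      if insub (i, j) is Some ij then inr ij
      else if insub (j, i) is Some ji then inr ji else p
  | _, _ => p
  end.

Definition fuse x y : part n := (x.1 + y.1, mul_color x.2 y.2).

(* The pairs of primary parts that are allowed in O and forbidden in E; they
   are exactly the halves of the secondary parts. *)
Definition close x y : bool :=
  [&& primary x.2, primary y.2, succ_part x y & succ_part (shift 1 y) x].

Lemma succ_partE x y :
  succ_part x y = (y.1 < x.1) || (y.1 == x.1) && ~~ color_le x.2 y.2.
Proof. by rewrite /succ_part; case: color_le => /=; lia. Qed.

Lemma color_le_inl (i j : 'I_n) :
  color_le (inl i : color n) (inl j) = (i <= j)%N.
Proof. by rewrite /color_le /=; lia. Qed.

Variant close_spec x y : part n -> Prop :=
| CloseEq k (i j : 'I_n) (ij : secondary n) of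
    (i < j)%N & val ij = (i, j) & x = (k, inl j) & y = (k, inl i) :
    close_spec x y (k + k, inr ij)
| CloseNext k (i j : 'I_n) (ij : secondary n) of
    (i < j)%N & val ij = (i, j) & x = (k + 1, inl i) & y = (k, inl j) :
    close_spec x y (k + k + 1, inr ij).

Lemma closeP x y : close x y -> close_spec x y (fuse x y).
Proof.
case: x y => [k [i|?]] [l [j|?]] //.
rewrite /close /= !succ_partE /= !color_le_inl.
rewrite /fuse /= => h.
case: insubP => [ij /= lt_ij eij|].
  have -> : k = l + 1 by lia.
  have -> : l + 1 + l = l + l + 1 by lia.
  exact: CloseNext eij _ _.
case: insubP => [ij /= lt_ij eij _|/=]; last by move=> ? ?; lia.
by have -> : k = l by [lia]; apply: CloseEq eij _ _.
Qed.

Lemma gg_shift k x y : gg_part (shift k x) (shift k y) = gg_part x y.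
Proof.
case: x y => [l p] [m q]; rewrite /gg_part /succeq_part /succ_part /shift /=.
rewrite /incr_part !xpair_eqE /=.
have -> : l + k - (m + k) = l - m by lia.
have -> : l + k - (m + k + 1) = l - (m + 1) by lia.
by have -> : (l + k == m + k + 1) = (l == m + 1) by lia.
Qed.

Lemma shiftD k l x : shift k (shift l x) = shift (l + k) x.
Proof. by rewrite /shift /= addrA. Qed.

Lemma shift0 x : shift 0 x = x.
Proof. by case: x => k p; rewrite /shift /= addr0. Qed.

Lemma shift_inj k : injective (shift k).
Proof. by move=> [l p] [m q] [/addIr-> ->]. Qed.

Ltac cmp := rewrite /gg_part /succeq_part /shift /incr_part /= ?succ_partE /=;
  rewrite ?color_le_inl ?xpair_eqE /= /color_le /=.

Lemma gg_primaryE x y : primary x.2 -> primary y.2 ->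
  gg_part x y = ~~ succ_part (shift 1 y) x.
Proof.
case: x y => [k [i|?]] [l [j|?]] //= _ _; cmp.
by rewrite -[inl i == inl j]/(nat_of_ord i == nat_of_ord j); lia.
Qed.

(** As [succ_part] is a strict total order, a failing [z >> s] puts [s + 1] strictly above [z], that
    is, above [(z - 1) + 1]. *)
Lemma gg_cross z s : primary z.2 -> ~~ primary s.2 -> ~~ gg_part z s ->
  gg_part (shift 1 s) (shift (-1) z).
Proof.
case: z s => [k [i|?]] [l [?|[[a b] /= lt_ab]]] //= _ _; cmp.
have := ltn_ord b; lia.
Qed.

(** Sizes suffice unless all three parts have size 1; the fused color then lies in the block of [v],
    above the color of [y]. *)
Lemma gg_fuse_primary w v y : close w v -> primary y.2 -> 1 <= y.1 ->
  succ_part v y -> gg_part (fuse w v) y.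
Proof.
move=> /closeP h; case: y => [l [j|?]] //= _.
have := ltn_ord j.
by case: h => k i i' [[a b] /= lt_ab] lt_ii' [? ?] ? ? /=; subst; cmp; lia.
Qed.

(** In the tightest case [k = 0] and the four sizes agree; the colors then decrease along [w], [v],
    [z], [y]: the first pattern of [special]. *)
Lemma gg_fuse_below w v z y (k : nat) : close w v -> close z y ->
  succ_part (shift (- k%:Z) v) z -> gg_part (fuse w v) (shift k (fuse z y)).
Proof.
move=> /closeP h /closeP h'.
case: h => l i i' [[a b] /= lt_ab] lt_ii' [? ?] ? ? /=; subst;
case: h' => m j j' [[c d] /= lt_cd] lt_jj' [? ?] ? ? /=; subst; cmp;
case: ifP; lia.
Qed.

(* Here [y < v < w <= z < y + 1]: the halves [v + 1, w] of the greater part and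
   [z, y] of the smaller one are cyclically nested, and the special pairs are
   what this pattern gives when its colors are pairwise distinct. *)
Lemma gg_fuse_nested w v z y : close w v -> close z y ->
  succ_part v y -> ~~ succ_part w z -> gg_part (shift 1 (fuse w v)) (fuse z y).
Proof.
move=> /closeP h /closeP h'.
case: h => l i i' [[a b] /= lt_ab] lt_ii' [? ?] ? ? /=; subst;
case: h' => m j j' [[c d] /= lt_cd] lt_jj' [? ?] ? ? /=; subst; cmp;
case: ifP; lia.
Qed.

(** The parity of the size tells the two shapes of [close_spec] apart. *)
Lemma fuse_inj w v z y : close w v -> close z y ->
  fuse w v = fuse z y -> w = z /\ v = y.
Proof.
move=> /closeP h /closeP h'.
case: h => l i i' ij lt_ii' eij ? ?; subst;
case: h' => m j j' ij' lt_jj' eij' ? ? /=; subst=> -[eqlm eqij];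
move: eij; rewrite eqij eij' => -[? ?]; subst;
by [have -> : l = m by [lia] | lia].
Qed.

(** Adding 1 to [fuse z y] turns its halves [z], [y] into [y + 1], [z]. So [v] is [z] when [k = 0],
    and each further unit raises the lower half by at most 1. *)
Lemma fuse_shift_succ w v z y x (k : nat) : close w v -> close z y ->
  fuse w v = shift k.+1 (fuse z y) -> succ_part (shift (- k%:Z) v) x ->
  primary x.2 -> succ_part z x.
Proof.
move=> /closeP h /closeP h'; case: x => [c [a|?]] //.
case: h => l i i' ij lt_ii' eij ? ?; subst;
case: h' => m j j' ij' lt_jj' eij' ? ? /=; subst=> -[eqlm eqij];
move: eij; rewrite eqij eij' => -[? ?]; subst; cmp; lia.
Qed.

Lemma fuse_secondary w v : close w v -> ~~ primary (fuse w v).2.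
Proof. by move=> /closeP; case. Qed.

Lemma fuse_monomial w v : close w v ->
  color_monomial (fuse w v).2 =
  (color_monomial w.2 + color_monomial v.2)%MM.
Proof.
by move=> /closeP; case=> k i j ij _ eij -> -> /=; rewrite eij //= addmC.
Qed.

Lemma closeE x y : primary x.2 -> primary y.2 -> succ_part x y ->
  ~~ gg_part x y -> close x y.
Proof. by move=> px py xy; rewrite gg_primaryE // negbK /close px py xy. Qed.

Lemma succ_trans : transitive (@succ_part n).
Proof.
by move=> [k p] [l q] [m r]; rewrite !succ_partE /color_le /=; lia.
Qed.

Lemma gg_succ x y : primary x.2 -> primary y.2 -> gg_part x y ->
  ~~ succ_part y (shift (-1) x).
Proof.
case: x y => [k [i|?]] [l [j|?]] //= px py; rewrite gg_primaryE //.
by rewrite !succ_partE /= !color_le_inl; lia.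
Qed.

Lemma succ_gg v x y : primary v.2 -> primary x.2 -> primary y.2 ->
  succ_part v x -> gg_part x y -> succ_part (shift (-1) v) y.
Proof.
case: v x y => [m [h|?]] [k [i|?]] [l [j|?]] //= pv px py.
by rewrite gg_primaryE // !succ_partE /= !color_le_inl; lia.
Qed.

Lemma nsucc_trans x y z : primary x.2 -> primary y.2 ->
  ~~ succ_part y x -> succ_part y z -> succ_part x z.
Proof.
case: x y z => [k [i|?]] [l [j|?]] [m r] //= _ _.
by rewrite !succ_partE /color_le /=; case: r => [?|[[??]?]] /=; lia.
Qed.

Lemma gg_primary_size x y : primary x.2 -> primary y.2 -> gg_part x y ->
  y.1 < x.1.
Proof.
case: x y => [k [i|?]] [l [j|?]] //= px py.
by rewrite gg_primaryE // succ_partE /=; lia.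
Qed.

(** * The construction step and its invariant *)

(* A partition under construction is stored from its last part to its first one,
   as [zs ++ F] where [zs] is the longest stretch of primary parts. *)
Definition state := (seq (part n) * seq (part n))%type.
Implicit Type st : state.

Definition word st := st.1 ++ st.2.

Fixpoint cross s zs : state :=
  if zs is z :: zs' then
    if gg_part z s then ([::], s :: zs)
    else let: (a, b) := cross (shift 1 s) zs' in (shift (-1) z :: a, b)
  else ([::], [:: s]).

Definition step st y : state :=
  if st.1 is z :: zs then
    if gg_part z y then (y :: st.1, st.2)
    else let: (a, b) := cross (fuse z y) zs in (a, b ++ st.2)
  else ([:: y], st.2).

Notation ll := (fun x y => gg_part y x).

(** Crossed parts are lowered together, so [gg_shift] keeps them ordered; [gg_cross] handles the
    last one crossed. *)
Lemma crossP s zs : all (fun z => primary z.2) zs -> ~~ primary s.2 ->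
  sorted ll zs ->
  exists a rest, let s' := shift (size a)%:Z s in
    [/\ zs = a ++ rest, cross s zs = (map (shift (-1)) a, s' :: rest),
        sorted ll (rcons (map (shift (-1)) a) s')
      & if rest is x :: _ then gg_part x s' else true].
Proof.
elim: zs s => [|z zs IH] s /=.
  by move=> _ _ _; exists [::], [::]; rewrite shift0.
case/andP=> pz pzs ps pth; case: ifP => [gg_zs|/negbT ngg].
  by exists [::], (z :: zs); rewrite shift0.
have [a [rest [ezs -> srt gg_rest]]] := IH (shift 1 s) pzs ps (path_sorted pth).
exists (z :: a), rest; rewrite /= shiftD in srt gg_rest *.
have e : 1 + (size a)%:Z = (size a).+1%:Z by lia.
rewrite e in srt gg_rest *; split=> //; first by rewrite ezs.
case: a e srt ezs {gg_rest IH} => [_ _ _|u a e srt ezs] /=.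
  by rewrite gg_cross.
by move: pth; rewrite ezs => /= /andP[gg_uz _]; rewrite gg_shift gg_uz.
Qed.

(* The last secondary part was created from its halves [w] and [v] by the last
   fusion, then crossed all of [zs]. *)
Definition just_fused v st : Prop := exists w F,
  [/\ close w v, st.2 = shift (size st.1)%:Z (fuse w v) :: F
    & if st.1 is z :: _ then ~~ succ_part w z else true].

(* The last secondary part crossed [r] parts after its creation, and then
   [k + 1] primary parts were appended, [z] being the last one. *)
Definition appended st : Prop := exists w v z zs F (r k : nat),
  [/\ close w v, st = (z :: zs, shift r%:Z (fuse w v) :: F),
      size zs = (r + k)%N & succ_part (shift (- k%:Z) v) z].

(** The invariant under which [y] can be added. Positivity of [y] is left out to allow the dummy
    part of [build_spec], which may have size 0. *)
Record addable st y : Prop := Addable {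
  add_primary : all (@primary_part n) st.1;
  add_parts : all (fun x => primary_part x || secondary_part x) st.2;
  add_sorted : sorted ll (word st);
  add_color : primary y.2;
  add_succ : if st.1 is z :: _ then succ_part z y else true;
  add_last : [\/ st.2 = [::],
                 exists2 v, just_fused v st & succ_part v y
               | appended st] }.

Lemma sub_primary zs :
  all (@primary_part n) zs -> all (fun z => primary z.2) zs.
Proof. by apply: sub_all => z /andP[]. Qed.

Definition secondary_head F : bool :=
  if F is t :: _ then ~~ primary t.2 else true.

Lemma add_secondary st y : addable st y -> secondary_head st.2.
Proof.
case=> _ _ _ _ _ [-> //|[v [w [F [wv -> _]]] _]|].
  by rewrite /= fuse_secondary.
by case=> w [v [z [zs [F [r [k [wv -> _ _]]]]]]] /=; rewrite fuse_secondary.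
Qed.

Variant step_spec st y : state -> Prop :=
| StepPush of (if st.1 is z :: _ then gg_part z y else true) :
    step_spec st y (y :: st.1, st.2)
| StepFuse z a rest of st.1 = z :: a ++ rest & close z y &
    sorted ll (rcons (map (shift (-1)) a) (shift (size a)%:Z (fuse z y))) &
    (if rest is x :: _ then gg_part x (shift (size a)%:Z (fuse z y))
     else true) :
    step_spec st y
      (map (shift (-1)) a, shift (size a)%:Z (fuse z y) :: rest ++ st.2).

Lemma stepP st y : addable st y -> step_spec st y (step st y).
Proof.
case: st => zs F [/= prim _ srt py zy _]; rewrite /step.
case: zs prim srt zy => [|z zs] /= prim srt zy; first exact: StepPush.
case: ifP => [gg_zy|/negbT ngg]; first exact: StepPush.
case/andP: prim => /andP[pz _] prim.
have zyc := closeE pz py zy ngg.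
move: srt; rewrite /word /= cat_path => /andP[/path_sorted srt _].
have [a [rest [ezs -> srt_a gg_rest]]] :=
  crossP (sub_primary prim) (fuse_secondary zyc) srt.
apply: (@StepFuse (z :: zs, F)) => //=; first by rewrite ezs.
by case: (rest) gg_rest.
Qed.

Lemma shift_primary_part z u :
  primary_part z -> primary_part u -> z.1 < u.1 -> primary_part (shift (-1) u).
Proof.
by case/andP=> _ z_pos /andP[pu _] ltzu; rewrite /primary_part pu /=; lia.
Qed.

Lemma path_lt_size z zs :
  all (@primary_part n) (z :: zs) -> path ll z zs ->
  all (fun u => z.1 < u.1) zs.
Proof.
move=> prim; have := sub_primary prim => prim2 pth.
apply: (@order_path_min _ (fun x y => x.1 < y.1)).
  by move=> x y t; apply: lt_trans.
apply: sub_in_path prim2 pth => x y px py /= gg_yx.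
exact: gg_primary_size gg_yx.
Qed.

(** The first part appended after a fusion has [k = 0]; each later one is at least 1 below its
    predecessor, so [k] grows by 1. *)
Lemma appended_push st y : addable st y ->
  (if st.1 is z :: _ then gg_part z y else true) ->
  st.2 = [::] \/ appended (y :: st.1, st.2).
Proof.
case: st => zs F [/= prim _ _ py _ last_st] gg_y.
case: last_st => [eF|[v [w [F' [wv eF _]]] vy]|]; first by left.
  right; exists w, v, y, zs, F', (size zs), 0%N.
  by rewrite oppr0 shift0 addn0 -eF.
case=> w [v [z [zs' [F' [r [k [wv [ezs eF] ezs' vz]]]]]]]; subst zs F.
right; exists w, v, y, (z :: zs'), F', r, k.+1.
split; rewrite //= ?ezs' ?addnS //.
have -> : - (k.+1)%:Z = - k%:Z + -1 by lia.
have /and4P[_ pv _ _] := wv; have /andP[/andP[pz _] _] := prim.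
by rewrite -shiftD (succ_gg _ pz).
Qed.

Lemma just_fused_fuse st y z a rest : addable st y -> st.1 = z :: a ++ rest ->
  close z y -> just_fused y
    (map (shift (-1)) a, shift (size a)%:Z (fuse z y) :: rest ++ st.2).
Proof.
case: st => zs F [/= prim _ srt _ _ _] ezs zyc; subst zs.
exists z, (rest ++ F); rewrite /= size_map; split=> //.
case: a prim srt => [|u a] //= /and3P[/andP[pz _] /andP[pu _] _].
by case/andP=> gg_u _; apply: gg_succ.
Qed.

Lemma addable_step st y y' : addable st y -> primary_part y ->
  primary y'.2 -> succ_part y y' -> addable (step st y) y'.
Proof.
case: st => zs F add py py' yy'; have [/= prim parts srt py2 zy last_st] := add.
have y_pos : 1 <= y.1 by case/andP: py.
have [/= gg_y|z a rest /= ezs zyc srt_a gg_rest] := stepP add.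
  split=> //=; first by rewrite py.
    case: zs {add} prim srt zy last_st gg_y => [|z zs] /=; last first.
      by move=> _ srt _ _ gg_y; rewrite /word /= gg_y.
    move=> _ srt _ last_st _; rewrite /word /= in srt *.
    case: last_st => [/= -> //|[v [w [F' [wv /= eF _]]] vy]|]; last first.
      by case=> w [v [z [zs [F' [r [k [_ []]]]]]]].
    by move: srt; rewrite eF shift0 /= => ->; rewrite gg_fuse_primary.
  by case: (appended_push add gg_y) => ?; [apply: Or31|apply: Or33].
subst zs.
have [/andP[pz z_pos] prim_a prim_rest] : [/\ primary_part z,
    all (@primary_part n) a & all (@primary_part n) rest].
  by move: prim; rewrite /= all_cat => /and3P.
move: srt; rewrite /word /= -catA => srt.
have srtF : sorted ll (rest ++ F).
  by case: (cat_sorted2 (path_sorted srt)).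
have fs : ~~ primary (fuse z y).2 by apply: fuse_secondary.
split=> //=.
(* Crossed parts exceed [z] in size, so they stay positive when lowered. *)
- move: srt; rewrite catA !cat_path -andbA => /andP[srt _].
  have := path_lt_size _ srt.
  rewrite /= prim_a /primary_part pz z_pos => /(_ isT).
  rewrite all_map => lt_a; apply/allP => u u_a /=.
  apply: (@shift_primary_part z); rewrite /primary_part ?pz //.
    exact: (allP prim_a).
  exact: (allP lt_a).
- rewrite all_cat parts (sub_all _ prim_rest); last by move=> x ->.
  rewrite /primary_part /secondary_part /= (negbTE fs) !andbT /=.
  by move: y_pos z_pos; clear; lia.
- rewrite sorted_cat_cons srt_a /=.
  case: rest {add prim prim_rest srt srt_a} gg_rest srtF last_st;
    last by move=> x rest /= gg_x srtF _; rewrite gg_x.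
  rewrite cats0 => _ srtF [-> //|[v [w [F' [wv /= eF nwz]]] vy]|].
    move: srtF; rewrite eF /= => ->; rewrite andbT.
    (* The earlier secondary part crossed [z] and [a], the new one only [a]: a shift by 1
       remains. *)
    have -> : (size a).+1%:Z = 1 + (size a)%:Z by lia.
    by rewrite -shiftD gg_shift gg_fuse_nested.
  case=> w [v [u [zs [F' [r [k [wv [eu ezs eF] esize vu]]]]]]]; subst u zs F.
  (* The earlier secondary part crossed [r] parts, the new one [r + k]. *)
  move: srtF => /= ->; rewrite andbT esize PoszD addrC -shiftD gg_shift.
  exact: gg_fuse_below.
- case: a {add prim last_st srt_a gg_rest} prim_a srt => [|u a] //=.
  move=> /andP[/andP[pu _] _] /andP[gg_u _].
  exact: nsucc_trans (gg_succ pu pz gg_u) (succ_trans zy yy').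
by apply: Or32; exists y => //; apply: just_fused_fuse add _ zyc.
Qed.

(** * Undoing a step *)

Lemma appended_not_just_fused v st : all (@primary_part n) st.1 ->
  appended st -> ~ just_fused v st.
Proof.
move=> prim [w [v0 [z [zs [F [r [k [wv est esize vz]]]]]]]]; subst st.
case=> w' [F' [wv' /= [e1 e2 _] nwz]].
have /andP[/andP[pz _] _] := prim.
(* The two readings of the last secondary part give [fuse w v = shift k.+1 (fuse w' v')]. *)
suff: succ_part w' z by apply/negP.
apply: fuse_shift_succ wv wv' _ vz pz.
by rewrite /shift /= -e2; congr pair; move: e1; rewrite esize; clear; lia.
Qed.

Lemma cat_primary_inj zs1 zs2 F1 F2 :
  all (@primary_part n) zs1 -> all (@primary_part n) zs2 ->
  secondary_head F1 -> secondary_head F2 ->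
  zs1 ++ F1 = zs2 ++ F2 -> zs1 = zs2 /\ F1 = F2.
Proof.
elim: zs1 zs2 => [|z1 zs1 IH] [|z2 zs2] //=.
- by move=> _ /andP[/andP[pz _] _] h _ eF; rewrite eF /= pz in h.
- by move=> /andP[/andP[pz _] _] _ _ h eF; rewrite -eF /= pz in h.
by move=> /andP[_ p1] /andP[_ p2] h1 h2 [-> /(IH _ p1 p2 h1 h2)[-> ->]].
Qed.

(** Appending leaves no secondary part or an [appended] state, fusing a [just_fused] one, so both
    steps are of the same kind. For a fusion, the number of parts behind the new secondary part
    gives its shift, and [fuse_inj] its halves. *)
Lemma step_inj st1 st2 y1 y2 : addable st1 y1 -> addable st2 y2 ->
  primary_part y1 -> primary_part y2 ->
  step st1 y1 = step st2 y2 -> st1 = st2 /\ y1 = y2.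
Proof.
have push_fuse st st' y y' z a rest : addable st y -> addable st' y' ->
    (if st.1 is z :: _ then gg_part z y else true) -> primary_part y ->
    st'.1 = z :: a ++ rest -> close z y' ->
    (y :: st.1, st.2) <>
      (map (shift (-1)) a, shift (size a)%:Z (fuse z y') :: rest ++ st'.2).
  move=> add add' gg_y py ezs zyc e.
  have := just_fused_fuse add' ezs zyc; rewrite -e.
  case: (appended_push add gg_y) => [eF|]; first by case: e; rewrite eF.
  by apply: appended_not_just_fused; rewrite /= py (add_primary add).
move=> add1 add2 py1 py2.
have sec1 := add_secondary add1; have sec2 := add_secondary add2.
have prim1 := add_primary add1; have prim2 := add_primary add2.
have [gg1|z1 a1 rest1 ezs1 zyc1 _ _] := stepP add1;
have [gg2|z2 a2 rest2 ezs2 zyc2 _ _] := stepP add2.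
- rewrite [st1]surjective_pairing [st2]surjective_pairing.
  by case=> -> -> ->.
- by move/(push_fuse _ _ _ _ _ _ _ add1 add2 gg1 py1 ezs2 zyc2).
- by move/esym/(push_fuse _ _ _ _ _ _ _ add2 add1 gg2 py2 ezs1 zyc1).
move=> [/(inj_map (@shift_inj (-1))) ea e1 e2 eF]; subst a2.
have /(fuse_inj zyc1 zyc2)[ez ey] : fuse z1 y1 = fuse z2 y2.
  by rewrite /fuse e2; congr pair; move: e1; clear; lia.
subst z2 y2.
move: prim1 prim2; rewrite ezs1 ezs2 /= !all_cat.
move=> /and3P[_ _ pr1] /and3P[_ _ pr2].
have [er eF'] := cat_primary_inj pr1 pr2 sec1 sec2 eF; subst rest2.
by rewrite [st1]surjective_pairing ezs1 eF' -ezs2 -surjective_pairing.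
Qed.

(** * The map from O to E, its injectivity and what it conserves *)

Definition build (s : seq (part n)) : state := foldl step ([::], [::]) s.

Lemma in_O_rcons (s : seq (part n)) y : in_O (rcons s y) =
  [&& in_O s, primary_part y
    & if s is x :: s' then succ_part (last x s') y else true].
Proof.
rewrite /in_O all_rcons; case: s => [|x s] /=; first by rewrite !andbT.
by rewrite rcons_path; case: (primary_part y); rewrite ?andbF //= andbA.
Qed.

Lemma build_addable (s : seq (part n)) y : in_O s -> primary y.2 ->
  (if s is x :: s' then succ_part (last x s') y else true) ->
  addable (build s) y.
Proof.
elim/last_ind: s y => [|s x IH] y.
  by move=> _ py _; split=> //; apply: Or31.
rewrite in_O_rcons => /and3P[Os px sx] py xy; rewrite /build foldl_rcons.
apply: addable_step => //; first by apply: IH => //; case/andP: px.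
by case: s xy {IH Os sx} => [|? ?] //=; rewrite last_rcons.
Qed.

Lemma step_neq0 st y : addable st y -> step st y <> ([::], [::]).
Proof. by move=> add; case: (stepP add). Qed.

Lemma build_inj (s1 s2 : seq (part n)) :
  in_O s1 -> in_O s2 -> build s1 = build s2 -> s1 = s2.
Proof.
have add_rcons (s : seq (part n)) x :
    in_O (rcons s x) -> addable (build s) x /\ primary_part x.
  rewrite in_O_rcons => /and3P[Os px sx]; split=> //.
  by apply: build_addable => //; case/andP: px.
elim/last_ind: s1 s2 => [|s1 x1 IH] s2; case/lastP: s2 => [|s2 x2] //.
- move=> _ /add_rcons[add _]; rewrite {2}/build foldl_rcons => /esym.
  by case/(step_neq0 add).
- move=> /add_rcons[add _] _; rewrite {1}/build foldl_rcons.
  by case/(step_neq0 add).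
move=> O1 O2.
have [add1 p1] := add_rcons _ _ O1; have [add2 p2] := add_rcons _ _ O2.
rewrite /build !foldl_rcons => /(step_inj add1 add2 p1 p2)[e ->].
move: O1 O2; rewrite !in_O_rcons => /andP[O1 _] /andP[O2 _].
by rewrite (IH s2).
Qed.

Lemma build_spec (s : seq (part n)) (st := build s) : in_O s ->
  [/\ all (@primary_part n) st.1,
      all (fun x => primary_part x || secondary_part x) st.2,
      sorted ll (word st)
    & secondary_head st.2].
Proof.
case/lastP: s @st => [|s x] //= Os; set st := build _.
have := Os; rewrite in_O_rcons => /and3P[_ /andP[px _] _].
(* The invariant needs a next part: the last one lowered by 1 serves. *)
have add : addable st (shift (-1) x).
  apply: build_addable => //; case: s {st} Os => [|z s] /= _.
    by rewrite succ_partE /=; lia.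
  by rewrite last_rcons succ_partE /=; lia.
by have sec := add_secondary add; case: add.
Qed.

Definition fuse_all (s : seq (part n)) := rev (word (build s)).

Lemma fuse_all_in_E (s : seq (part n)) : in_O s -> in_E (fuse_all s).
Proof.
case/build_spec=> prim parts srt _.
rewrite /in_E /fuse_all all_rev rev_sorted srt andbT all_cat parts andbT.
by apply: sub_all prim => x ->.
Qed.

Lemma fuse_all_inj (s1 s2 : seq (part n)) : in_O s1 -> in_O s2 ->
  fuse_all s1 = fuse_all s2 -> s1 = s2.
Proof.
move=> O1 O2 /(can_inj revK) e; apply: build_inj => //.
have [p1 _ _ h1] := build_spec O1; have [p2 _ _ h2] := build_spec O2.
have [e1 e2] := cat_primary_inj p1 p2 h1 h2 e.
by rewrite [build s1]surjective_pairing e1 e2 -surjective_pairing.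
Qed.

(** A general commutative monoid treats size and color at once: crossing and fusing conserve
    both. *)
Lemma big_word_step (T : Type) (idx : T) (op : Monoid.com_law idx)
    (f : part n -> T) st y :
  (forall z s, op (f (shift (-1) z)) (f (shift 1 s)) = op (f z) (f s)) ->
  (forall z y, close z y -> f (fuse z y) = op (f z) (f y)) ->
  addable st y ->
  \big[op/idx]_(x <- word (step st y)) f x =
  op (f y) (\big[op/idx]_(x <- word st) f x).
Proof.
move=> fS ff add.
have opA : associative op := Monoid.mulmA op.
have opCA : left_commutative op := Monoid.mulmCA op.
have fSa a s :
    op (\big[op/idx]_(x <- map (shift (-1)) a) f x) (f (shift (size a)%:Z s)) =
    op (\big[op/idx]_(x <- a) f x) (f s).
  elim: a s => [|z a IH] s; first by rewrite shift0 !big_nil.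
  rewrite /= !big_cons.
  have -> : shift (size a).+1%:Z s = shift (size a)%:Z (shift 1 s).
    by rewrite shiftD; congr shift; lia.
  by rewrite -[LHS]opA IH opCA fS opCA opA.
have [_|z a rest ezs zyc _ _] := stepP add; first by rewrite /word /= big_cons.
rewrite /word ezs /= !(big_cat, big_cons) /=.
rewrite [LHS]opA fSa (ff _ _ zyc) -!opA [RHS]opCA.
by rewrite [LHS]opCA; congr (op _ _); rewrite opCA.
Qed.

Lemma big_fuse_all (T : Type) (idx : T) (op : Monoid.com_law idx)
    (f : part n -> T) (s : seq (part n)) :
  (forall z s, op (f (shift (-1) z)) (f (shift 1 s)) = op (f z) (f s)) ->
  (forall z y, close z y -> f (fuse z y) = op (f z) (f y)) ->
  in_O s ->
  \big[op/idx]_(x <- fuse_all s) f x = \big[op/idx]_(x <- s) f x.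
Proof.
move=> fS ff; rewrite /fuse_all big_rev.
elim/last_ind: s => [|s x IH]; first by rewrite !big_nil.
rewrite in_O_rcons => /and3P[Os px sx].
rewrite /build foldl_rcons big_word_step //; last first.
  by apply: build_addable => //; case/andP: px.
by rewrite IH // -cats1 big_cat big_seq1 Monoid.mulmC.
Qed.

Lemma psize_fuse_all (s : seq (part n)) :
  in_O s -> psize (fuse_all s) = psize s.
Proof. by move=> Os; rewrite /psize big_fuse_all // => x t /=; lia. Qed.

Lemma pmonomial_fuse_all (s : seq (part n)) :
  in_O s -> pmonomial (fuse_all s) = pmonomial s.
Proof.
by move=> Os; rewrite /pmonomial big_fuse_all // => z y; apply: fuse_monomial.
Qed.

End Parts.

Theorem theorem1p3 (n : nat) (hn : (1 <= n)%N) (m : nat) (C : 'X_{1..n}) :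
  (U C m <= V C m)%N.
Proof.
have memO s : s \in fset_set (O_set C m) ->
    [/\ in_O s, pmonomial s = C & psize s = m%:Z].
  by rewrite in_fset_set ?inE //; exact: finite_O_set.
have inj : {in fset_set (O_set C m) &, injective (@fuse_all n)}.
  by move=> s1 s2 /memO[O1 _ _] /memO[O2 _ _]; apply: fuse_all_inj.
rewrite /U /V; have /card_in_imfsetP/eqP <- := inj.
apply/fsubset_leq_card/fsubsetP => _ /imfsetP[s /= /memO[Os sC sm] ->].
rewrite in_fset_set ?inE; last exact: finite_E_set.
by split; rewrite ?psize_fuse_all ?pmonomial_fuse_all ?fuse_all_in_E.
Qed.
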